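(* For a convex cone $E_+$ in a real vector space $E$, the following are equivalent: (i) $E_+$ is regular; (ii) The intersection of all supporting hyperplanes of $E_+$ is $\{0\}$; (iii) There is a topological space $\Omega$ and an injective positive linear map $E \to C(\Omega)$; (iv) There is a locally compact Hausdorff space $\Omega$ and an injective positive linear map $E \to C(\Omega)$.
   Context: A convex cone is a non-empty subset $\mathcal{K}$ with $\mathcal{K}+\mathcal{K}\subseteq\mathcal{K}$ and $\lambda\mathcal{K}\subseteq\mathcal{K}$ for all $\lambda\ge0$. The cone $E_+$ is called regular if its algebraic dual cone $E_+^*$ (the set of all linear functionals $E\to\mathbb{R}$ that are non-negative on $E_+$) separates points on $E$, i.e. for every $x\neq0$ in $E$ there is $\varphi\in E_+^*$ with $\varphi(x)\neq0$. (By a known theorem of Schaefer this is equivalent to: the closure of $E_+$ in the finest locally convex topology on $E$ is a proper cone, i.e. contains no non-zero $x$ together with $-x$.) A supporting hyperplane of $E_+$ is an affine hyperplane $H=\{x\in E:\varphi(x)=\alpha\}$, with $\varphi$ a non-zero linear functional on $E$ and $\alpha\in\mathbb{R}$, such that $E_+\subseteq\{x:\varphi(x)\ge\alpha\}$ and $E_+\cap H\neq\emptyset$. The intersection of an empty family of hyperplanes is $E$. $C(\Omega)$ is the vector space of all continuous functions $\Omega\to\mathbb{R}$, with the cone of everywhere non-negative functions. A linear map $T:E\to F$ is positive if $T[E_+]\subseteq F_+$. *)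

(* Defs.v *)
From HB Require Import structures.
From mathcomp Require Import all_boot all_order all_algebra.
From mathcomp Require Import all_classical all_reals topology normedtype.
Set Implicit Arguments.
Unset Strict Implicit.
Unset Printing Implicit Defensive.
Import Order.TTheory GRing.Theory Num.Theory.
Import numFieldNormedType.Exports.
Local Open Scope classical_set_scope.
Local Open Scope ring_scope.

Section cone.
Context (R : realType) (E : lmodType R).
Implicit Types K H : set E.

Definition convex_cone K : Prop :=
  [/\ K !=set0,
      forall x y, K x -> K y -> K (x + y) &
      forall (l : R) x, 0 <= l -> K x -> K (l *: x)].

Definition dual_cone K : set {linear E -> R^o} :=
  [set phi | forall x, K x -> 0 <= phi x].

Definition regular_cone K : Prop :=
  forall x : E, x != 0 -> exists2 phi, dual_cone K phi & phi x != 0.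

Definition supporting_hyperplane K H : Prop :=
  exists (phi : {linear E -> R^o}) (a : R),
    [/\ (exists x, phi x != 0),
        H = [set x | phi x = a],
        K `<=` [set x | a <= phi x] &
        K `&` H !=set0].

End cone.

Definition positive_map (R : realType) (E F : lmodType R)
  (K : set E) (L : set F) (T : {linear E -> F}) : Prop := T @` K `<=` L.

(* C(Omega) is [continuousType Omega R]; the library gives it no algebraic
   structure, so its pointwise vector space structure is built here. *)
Section continuous_functions.
Context (R : realType) (Omega : topologicalType).
Implicit Types f g h : continuousType Omega R.

Lemma cts_zero_continuous : continuous (fun _ : Omega => 0 : R).
Proof. by move=> x; exact: cvg_cst. Qed.

Lemma cts_opp_continuous f : continuous (fun w => - f w).
Proof. by move=> x; apply: cvgN; exact: cts_fun. Qed.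

Lemma cts_add_continuous f g : continuous (fun w => f w + g w).
Proof. by move=> x; apply: cvgD; exact: cts_fun. Qed.

Lemma cts_scale_continuous (l : R) f : continuous (fun w => l * f w).
Proof. by move=> x; apply: cvgM; [exact: cvg_cst | exact: cts_fun]. Qed.

Definition cts_zero : continuousType Omega R := mkcts cts_zero_continuous.
Definition cts_opp f : continuousType Omega R :=
  mkcts (cts_opp_continuous (f := f)).
Definition cts_add f g : continuousType Omega R :=
  mkcts (cts_add_continuous (f := f) (g := g)).
Definition cts_scale (l : R) f : continuousType Omega R :=
  mkcts (cts_scale_continuous (l := l) (f := f)).

Lemma cts_addA : associative cts_add.
Proof. by move=> f g h; apply/continuousEP => w; exact: addrA. Qed.
Lemma cts_addC : commutative cts_add.
Proof. by move=> f g; apply/continuousEP => w; exact: addrC. Qed.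
Lemma cts_add0 : left_id cts_zero cts_add.
Proof. by move=> f; apply/continuousEP => w; exact: add0r. Qed.
Lemma cts_addN : left_inverse cts_zero cts_opp cts_add.
Proof. by move=> f; apply/continuousEP => w; exact: addNr. Qed.

HB.instance Definition _ := GRing.isZmodule.Build (continuousType Omega R)
  cts_addA cts_addC cts_add0 cts_addN.

Lemma cts_scaleA (a b : R) f : cts_scale a (cts_scale b f) = cts_scale (a * b) f.
Proof. by apply/continuousEP => w; exact: mulrA. Qed.
Lemma cts_scale1 : left_id 1 cts_scale.
Proof. by move=> f; apply/continuousEP => w; exact: mul1r. Qed.
Lemma cts_scaleDr : right_distributive cts_scale +%R.
Proof. by move=> a f g; apply/continuousEP => w; exact: mulrDr. Qed.
Lemma cts_scaleDl f : {morph cts_scale^~ f : a b / a + b}.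
Proof. by move=> a b; apply/continuousEP => w; exact: mulrDl. Qed.

HB.instance Definition _ := GRing.Zmodule_isLmodule.Build R
  (continuousType Omega R) cts_scaleA cts_scale1 cts_scaleDr cts_scaleDl.

Definition nonneg_continuous : set (continuousType Omega R) :=
  [set f | forall w, 0 <= f w].

End continuous_functions.

(* Main.v *)
Require Import Defs.
From HB Require Import structures.
From mathcomp Require Import all_boot all_order all_algebra.
From mathcomp Require Import all_classical all_reals topology normedtype.
Import Order.TTheory GRing.Theory Num.Theory.
Import numFieldNormedType.Exports.
Local Open Scope classical_set_scope.
Local Open Scope ring_scope.

(** The cone enters every condition only through the positive functionals.

    A supporting hyperplane of a cone always passes through the origin: the
    level set touches the cone at some point k, and scaling k by 0 and by 2
    forces the level to vanish.  Hence the supporting hyperplanes are exactly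
    the kernels of the nonzero positive functionals
    ([supporting_hyperplane_kernel], [kernel_supporting_hyperplane]), and they
    meet only in the origin if and only if the positive functionals separate
    points.

    A positive map into a space of continuous functions, followed by evaluation
    at a point, is a positive functional ([regular_of_function_map]); an
    injective one therefore provides enough of them.  Conversely, evaluation
    sends a vector to a function on the set of all positive functionals, and
    regularity says that this map is injective.  It remains to topologize that
    set so that the functions are continuous; the discrete topology does this,
    and it is locally compact and Hausdorff
    ([regular_locally_compact_function_map]). *)

Section supporting_hyperplanes.
Set Implicit Arguments.
Context (R : realType) (E : lmodType R) (K : set E).

Lemma cone0 : convex_cone K -> K 0.
Proof. by case=> -[x Kx] _ Kscale; rewrite -(scale0r x); exact: Kscale. Qed.

(** The level [a] is the minimum of the functional on the cone; it is at most
    the value at 0, and at most the value [2 * a] at twice a minimizer. *)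
Lemma supporting_hyperplane_kernel (H : set E) :
  convex_cone K -> supporting_hyperplane K H ->
  exists2 phi, dual_cone K phi & H = [set x | phi x = 0].
Proof.
move=> hK [phi [a [_ -> Kge [k [Kk /= phik]]]]].
have a0 : a = 0.
  apply/eqP; rewrite eq_le; apply/andP; split.
    by have := Kge _ (cone0 hK); rewrite /= linear0.
  case: hK => _ Kadd _; have := Kge _ (Kadd _ _ Kk Kk).
  by rewrite /= linearD phik lerDl.
by rewrite a0 in Kge *; exists phi => // x Kx; exact: Kge.
Qed.

Lemma kernel_supporting_hyperplane (phi : {linear E -> R^o}) (x : E) :
  convex_cone K -> dual_cone K phi -> phi x != 0 ->
  supporting_hyperplane K [set y | phi y = 0].
Proof.
move=> hK phiK phix; exists phi, 0; split=> //; first by exists x.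
by exists 0; split; [exact: cone0 | rewrite /= linear0].
Qed.

Lemma regular_cone_supporting_hyperplaneP :
  convex_cone K ->
  regular_cone K <-> \bigcap_(H in supporting_hyperplane K) H = [set 0].
Proof.
move=> hK; split=> [Kreg|Kcap x x0].
  rewrite eqEsubset; split=> [x xcap|_ -> H /(supporting_hyperplane_kernel hK)].
    apply: contrapT => /eqP x0; have [phi phiK phix] := Kreg x x0.
    move: (phix); rewrite (xcap _ (kernel_supporting_hyperplane x hK phiK phix)).
    by rewrite eqxx.
  by move=> [phi _ ->]; rewrite /= linear0.
apply: contrapT => nophi; move/eqP: x0; apply.
have : [set 0] x; last by [].
rewrite -Kcap => H /(supporting_hyperplane_kernel hK)[phi phiK ->] /=.
by apply: contrapT => /eqP phix; apply: nophi; exists phi.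
Qed.

End supporting_hyperplanes.

Section evaluation_functional.
Context (R : realType) (E : lmodType R) (Omega : topologicalType).
Context (T : {linear E -> continuousType Omega R}) (w : Omega).

Definition eval_at (x : E) : R^o := T x w.

Lemma eval_at_is_linear : linear eval_at.
Proof. by move=> a x y; rewrite /eval_at linearP. Qed.

HB.instance Definition _ := GRing.isLinear.Build R E R^o *:%R eval_at
  eval_at_is_linear.

End evaluation_functional.

(** A nonzero vector has a nonzero image, and evaluating that image at a point
    where it does not vanish is a positive functional. *)
Lemma regular_of_function_map (R : realType) (E : lmodType R) (K : set E)
    (Omega : topologicalType) (T : {linear E -> continuousType Omega R}) :
  injective T -> positive_map K (@nonneg_continuous R Omega) T ->
  regular_cone K.
Proof.
move=> Tinj Tpos x x0; apply: contrapT => nophi; move/eqP: x0; apply.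
apply: Tinj; rewrite linear0; apply/continuousEP => w.
apply: contrapT => /eqP Txw; apply: nophi; exists (eval_at T w) => //.
by move=> y Ky; apply: Tpos; exists y.
Qed.

Section discrete_space.
Set Implicit Arguments.
Context (X : discreteTopologicalType).

Lemma discrete_continuous (Y : topologicalType) (f : X -> Y) : continuous f.
Proof.
by move=> x A /nbhs_singleton fxA; rewrite nbhs_principalE; apply/principal_filterP.
Qed.

Lemma discrete_locally_compact : locally_compact [set: X].
Proof.
move=> x _; exists [set x]; first by apply: filterS (discrete_set1 x).
by split; [exact: compact_set1 | exact: discrete_closed].
Qed.

End discrete_space.

Section positive_functionals.
Set Implicit Arguments.
Context (R : realType) (E : lmodType R) (K : set E).

(** The classical alias equips the positive functionals with the choice
    structure that a discrete space is built on. *)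
Definition positive_functionals : Type :=
  discrete_topology {classic {phi : {linear E -> R^o} | dual_cone K phi}}.

HB.instance Definition _ := DiscreteTopology.on positive_functionals.

Definition evaluation (x : E) : continuousType positive_functionals R :=
  mkcts (@discrete_continuous positive_functionals R
    (fun phi => proj1_sig phi x)).

Lemma evaluation_is_linear : linear evaluation.
Proof. by move=> a x y; apply/continuousEP => phi; exact: linearP. Qed.

HB.instance Definition _ := GRing.isLinear.Build R E
  (continuousType positive_functionals R) *:%R evaluation evaluation_is_linear.

Lemma evaluation_positive :
  positive_map K (@nonneg_continuous R positive_functionals) evaluation.
Proof. by move=> _ [x Kx <-] [phi phiK]; exact: phiK. Qed.

(** Two vectors with the same image differ by a vector that every positive
    functional kills. *)
Lemma evaluation_injective : regular_cone K -> injective evaluation.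
Proof.
move=> Kreg x y /continuousEP exy; apply/eqP; rewrite -subr_eq0.
apply: contrapT => /negP /Kreg[phi phiK]; rewrite linearB subr_eq0.
by move/eqP; apply; exact: (exy (exist _ phi phiK)).
Qed.

Lemma regular_locally_compact_function_map : regular_cone K ->
  exists (Omega : topologicalType) (T : {linear E -> continuousType Omega R}),
    [/\ locally_compact [set: Omega], hausdorff_space Omega,
        injective T & positive_map K (@nonneg_continuous R Omega) T].
Proof.
move=> Kreg; exists positive_functionals, evaluation.
split; [exact: discrete_locally_compact | exact: discrete_hausdorff | |].
  exact: evaluation_injective.
exact: evaluation_positive.
Qed.

End positive_functionals.

Theorem corollaryC (R : realType) (E : lmodType R) (K : set E)
    (hK : convex_cone K) :
  [<-> regular_cone K;
       \bigcap_(H in supporting_hyperplane K) H = [set 0];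
       exists (Omega : topologicalType)
              (T : {linear E -> continuousType Omega R}),
         injective T /\ positive_map K (@nonneg_continuous R Omega) T;
       exists (Omega : topologicalType)
              (T : {linear E -> continuousType Omega R}),
         [/\ locally_compact [set: Omega], hausdorff_space Omega,
             injective T & positive_map K (@nonneg_continuous R Omega) T]].
Proof.
tfae.
- by move/(regular_cone_supporting_hyperplaneP hK).
- move/(regular_cone_supporting_hyperplaneP hK).
  move/regular_locally_compact_function_map => [Omega [T [_ _ Tinj Tpos]]].
  by exists Omega, T.
- move=> [Omega [T [Tinj Tpos]]]; apply: regular_locally_compact_function_map.
  exact: regular_of_function_map _ _ _ _ _ Tinj Tpos.
- by move=> [Omega [T [_ _ Tinj Tpos]]]; exact: regular_of_function_map _ _ _ _ _ Tinj Tpos.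
Qed.
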